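(* Let $n\in\mathbb N$. The nonsymmetric divided powers functor $\gamma_n$ induces a functor $$\gamma_n:\mathsf{Op}^{\mathsf{ax}_n}\to\mathsf{Op}^{\mathsf{nu}}$$ from the category of nonsymmetric operads endowed with $n$-axial structures to the category of nonunital, nonsymmetric operads; that is, for every operad $\mathcal P$ with $n$-axial structure the sequence $\gamma_n(\mathcal P)$ carries the structure of a nonunital operad, functorially with respect to morphisms in $\mathsf{Op}^{\mathsf{ax}_n}$.
   Context: All sequences and operads here are nonsymmetric and in simplicial sets. For a sequence $\mathcal X=(\mathcal X(m))_{m\ge0}$, $\gamma_n(\mathcal X)$ is the sequence with $\gamma_n(\mathcal X)(m)=\mathcal X(mn)$. $\mathsf{Op}^{\mathsf{nu}}$ is the category of sequences $\mathcal P$ endowed with an associative multiplication $\mu:\mathcal P\circ\mathcal P\to\mathcal P$ with respect to the nonsymmetric composition product $(\mathcal X\circ\mathcal Y)(m)=\coprod_k\coprod_{m_1+\cdots+m_k=m}\mathcal X(k)\times\mathcal Y(m_1)\times\cdots\times\mathcal Y(m_k)$, not necessarily with a unit. An $n$-axial structure on a nonsymmetric operad $(\mathcal P,\mu)$ is a set $\{\iota_k:\mathcal P(kn)\to\mathcal P(k)^{\times n}\mid k\ge0\}$ of simplicial monomorphisms such that for all $k\ge1$ and $m_1,\dots,m_k\in\mathbb N$, with $m=\sum_im_i$, the composite $$\mathcal P(kn)\times\mathcal P(m_1n)\times\cdots\times\mathcal P(m_kn)\xrightarrow{\iota_k\times\iota_{m_1}\times\cdots\times\iota_{m_k}}\mathcal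 P(k)^{\times n}\times\mathcal P(m_1)^{\times n}\times\cdots\times\mathcal P(m_k)^{\times n}\cong\big(\mathcal P(k)\times\mathcal P(m_1)\times\cdots\times\mathcal P(m_k)\big)^{\times n}\xrightarrow{\mu^{\times n}}\mathcal P(m)^{\times n}$$ factors through $\iota_m:\mathcal P(mn)\to\mathcal P(m)^{\times n}$, i.e. equals $\iota_m\widehat\mu$ for some (necessarily unique) $\widehat\mu:\mathcal P(kn)\times\mathcal P(m_1n)\times\cdots\times\mathcal P(m_kn)\to\mathcal P(mn)$. $\mathsf{Op}^{\mathsf{ax}_n}$ is the category of operads endowed with $n$-axial structures and operad morphisms commuting with the maps $\iota_k$. *)

(* Defs.v *)
From mathcomp Require Import all_boot all_order boolp.

Set Implicit Arguments.
Unset Strict Implicit.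
Unset Printing Implicit Defensive.

Record category := Category {
  obj :> Type;
  hom : obj -> obj -> Type;
  idm : forall x, hom x x;
  cmp : forall x y z, hom y z -> hom x y -> hom x z;
  cmp1m : forall x y (f : hom x y), cmp (idm y) f = f;
  cmpm1 : forall x y (f : hom x y), cmp f (idm x) = f;
  cmpA : forall x y z t (h : hom z t) (g : hom y z) (f : hom x y),
    cmp h (cmp g f) = cmp (cmp h g) f
}.
Arguments idm {c}.

Lemma sval_eq (T : Type) (P : T -> Prop) (x y : {x | P x}) :
  sval x = sval y -> x = y.
Proof. by case: x y => [x xP] [y yP] /= xy; apply: eq_exist. Qed.

Reserved Notation "g \oc f" (at level 50, left associativity).
Notation "g \oc f" := (cmp g f).

Definition opcat (C : category) : category :=
  @Category C (fun x y => hom y x) (@idm C) (fun x y z g f => f \oc g)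
    (fun x y f => cmpm1 f) (fun x y f => cmp1m f)
    (fun x y z t h g f => esym (cmpA f g h)).

Definition types : category :=
  @Category Type (fun A B => A -> B) (fun A x => x)
    (fun A B C g f x => g (f x))
    (fun _ _ _ => erefl) (fun _ _ _ => erefl) (fun _ _ _ _ _ _ _ => erefl).

Record functor (C D : category) := Functor {
  fob :> C -> D;
  fmap : forall x y, hom x y -> hom (fob x) (fob y);
  fmap1 : forall x, fmap (idm x) = idm (fob x);
  fmapM : forall x y z (g : hom y z) (f : hom x y),
    fmap (g \oc f) = fmap g \oc fmap f
}.

Definition fcomp (C D E : category) (G : functor D E) (F : functor C D) :
  functor C E.
Proof.
refine (@Functor C E (fun x => G (F x)) (fun x y f => fmap G (fmap F f)) _ _).
- by move=> x; rewrite !fmap1.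
- by move=> x y z g f; rewrite !fmapM.
Defined.

Record nattrans (C D : category) (F G : functor C D) := NatTrans {
  nt :> forall x, hom (F x) (G x);
  ntP : forall x y (f : hom x y), nt y \oc fmap F f = fmap G f \oc nt x
}.

Lemma nattrans_eq (C D : category) (F G : functor C D) (a b : nattrans F G) :
  (forall x, a x = b x) -> a = b.
Proof.
case: a b => [a aP] [b bP] /= ab.
have {}ab : a = b by apply: functional_extensionality_dep.
by subst b; congr NatTrans.
Qed.

Definition nattrans_id (C D : category) (F : functor C D) : nattrans F F :=
  NatTrans (fun x y f => etrans (cmp1m (fmap F f)) (esym (cmpm1 (fmap F f)))).

Definition nattrans_cmp (C D : category) (F G H : functor C D)
  (b : nattrans G H) (a : nattrans F G) : nattrans F H.
Proof.
refine (@NatTrans C D F H (fun x => b x \oc a x) _).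
by move=> x y f; rewrite -cmpA ntP cmpA ntP -cmpA.
Defined.

Definition functors (C D : category) : category.
Proof.
refine (@Category (functor C D) (@nattrans C D) (@nattrans_id C D)
  (@nattrans_cmp C D) _ _ _).
- by move=> F G a; apply: nattrans_eq => x; apply: cmp1m.
- by move=> F G a; apply: nattrans_eq => x; apply: cmpm1.
- by move=> F G H K c b a; apply: nattrans_eq => x; apply: cmpA.
Defined.

Definition monic (C : category) (x y : C) (f : hom x y) : Prop :=
  forall (z : C) (g h : hom z x), f \oc g = f \oc h -> g = h.

(* The objects of a category C with extra structure (given by the type T with
   forgetful map u), with the morphisms of C satisfying M, and the associated
   forgetful functor to C. *)
Section Structured.
Variables (C : category) (T : Type) (u : T -> C).
Variable M : forall P Q : T, hom (u P) (u Q) -> Prop.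
Hypothesis M1 : forall P, M (idm (u P)).
Hypothesis MM : forall (P Q R : T) (g : hom (u Q) (u R)) (f : hom (u P) (u Q)),
  M g -> M f -> M (g \oc f).

Definition structured : category.
Proof.
refine (@Category T (fun P Q => {f : hom (u P) (u Q) | M f})
  (fun P => exist _ _ (M1 P))
  (fun P Q R g f => exist _ _ (MM (svalP g) (svalP f))) _ _ _).
- by move=> P Q f; apply: sval_eq; apply: cmp1m.
- by move=> P Q f; apply: sval_eq; apply: cmpm1.
- by move=> P Q R S h g f; apply: sval_eq; apply: cmpA.
Defined.

Definition forget : functor structured C :=
  @Functor structured C u (fun P Q f => sval f) (fun _ => erefl)
    (fun _ _ _ _ _ => erefl).

End Structured.

Definition simplex_hom (p q : nat) : Type :=
  {f : 'I_p.+1 -> 'I_q.+1 | {homo f : i j / i <= j}}.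

Definition simplex_id (p : nat) : simplex_hom p p :=
  @exist _ (fun f : 'I_p.+1 -> 'I_p.+1 => {homo f : i j / i <= j}) id (fun _ _ => id).

Definition simplex_cmp (p q r : nat) (g : simplex_hom q r) (f : simplex_hom p q) :
  simplex_hom p r :=
  @exist _ (fun f : 'I_p.+1 -> 'I_r.+1 => {homo f : i j / i <= j})
    (fun i => sval g (sval f i))
    (fun i j ij => svalP g _ _ (svalP f _ _ ij)).

(* The object p stands for the ordinal [p] = {0 < ... < p}. *)
Definition simplex : category.
Proof.
by refine (@Category nat simplex_hom simplex_id simplex_cmp _ _ _) => *;
  apply: sval_eq.
Defined.

Definition sset : category := functors (opcat simplex) types.

Definition sset_of (X : functor (opcat simplex) types) : sset := X.
Definition lev (X : sset) (p : nat) : Type := (X : functor _ _) p.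
(* The action of an arbitrary morphism d : [p] -> [q] of the simplex category. *)
Definition face (X : sset) (p q : nat) (d : @hom simplex p q) :
  lev X q -> lev X p := @fmap _ _ (X : functor _ _) q p d.
Definition sapp (X Y : sset) (f : hom X Y) (p : nat) : lev X p -> lev Y p :=
  (f : nattrans _ _) p.

Definition mksset (L : nat -> Type)
  (a : forall p q, @hom simplex p q -> L q -> L p)
  (a1 : forall p x, a p p (idm (p : simplex)) x = x)
  (aM : forall p q r (e : @hom simplex q r) (d : @hom simplex p q) x,
    a p r (e \oc d) x = a p q d (a q r e x)) : sset :=
  sset_of (@Functor (opcat simplex) types L (fun q p d => a p q d)
    (fun p => funext (a1 p)) (fun r q p d e => funext (aM p q r e d))).

Definition mksmap (X Y : sset) (f : forall p, lev X p -> lev Y p)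
  (fP : forall p q (d : @hom simplex p q) x, f p (face d x) = face d (f q x)) :
  hom X Y :=
  @NatTrans (opcat simplex) types X Y f (fun q p d => funext (fP p q d)).

Lemma face1 (X : sset) p (x : lev X p) : face (idm (p : simplex)) x = x.
Proof. by rewrite /face (fmap1 (X : functor _ _) p). Qed.

Lemma faceM (X : sset) p q r (e : @hom simplex q r) (d : @hom simplex p q)
  (x : lev X r) : face (e \oc d) x = face d (face e x).
Proof. exact: (congr1 (@^~ x) (fmapM (X : functor _ _) (x := r) d e)). Qed.

Lemma sapp_face (X Y : sset) (f : hom X Y) p q (d : @hom simplex p q) x :
  sapp f (face d x) = face d (sapp f x).
Proof. exact: (congr1 (@^~ x) (ntP (f : nattrans _ _) d)). Qed.

Lemma smap_eq (X Y : sset) (f g : hom X Y) :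
  (forall p (x : lev X p), sapp f x = sapp g x) -> f = g.
Proof. by move=> fg; apply: nattrans_eq => p; apply: funext => x; apply: fg. Qed.

Definition sprod (X Y : sset) : sset.
Proof.
refine (@mksset (fun p => lev X p * lev Y p)%type
  (fun p q d xy => (face d xy.1, face d xy.2)) _ _).
- by move=> p [x y]; rewrite /= !face1.
- by move=> p q r e d [x y]; rewrite /= !faceM.
Defined.

Definition spi (I : Type) (X : I -> sset) : sset.
Proof.
refine (@mksset (fun p => forall i, lev (X i) p)
  (fun p q d x i => face d (x i)) _ _).
- by move=> p x; apply: functional_extensionality_dep => i; rewrite face1.
- by move=> p q r e d x; apply: functional_extensionality_dep => i; rewrite faceM.
Defined.

Definition scoprod (I : Type) (X : I -> sset) : sset.
Proof.
refine (@mksset (fun p => {i & lev (X i) p})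
  (fun p q d x => existT _ (projT1 x) (face d (projT2 x))) _ _).
- by move=> p [i x]; rewrite /= face1.
- by move=> p q r e d [i x]; rewrite /= faceM.
Defined.

Definition spow (X : sset) (n : nat) : sset := spi (fun _ : 'I_n => X).

Definition sconst (A : Type) : sset :=
  @mksset (fun _ => A) (fun _ _ _ x => x) (fun _ _ => erefl)
    (fun _ _ _ _ _ _ => erefl).

Definition sprod_map (X X' Y Y' : sset) (f : hom X X') (g : hom Y Y') :
  hom (sprod X Y) (sprod X' Y').
Proof.
refine (@mksmap (sprod X Y) (sprod X' Y')
  (fun p xy => (sapp f xy.1, sapp g xy.2)) _).
by move=> p q d [x y]; congr pair; apply: sapp_face.
Defined.

Definition spi_map (I : Type) (X Y : I -> sset) (f : forall i, hom (X i) (Y i)) :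
  hom (spi X) (spi Y).
Proof.
refine (@mksmap (spi X) (spi Y) (fun p x i => sapp (f i) (x i)) _).
by move=> p q d x; apply: functional_extensionality_dep => i; apply: sapp_face.
Defined.

Definition scoprod_map (I : Type) (X Y : I -> sset)
  (f : forall i, hom (X i) (Y i)) : hom (scoprod X) (scoprod Y).
Proof.
refine (@mksmap (scoprod X) (scoprod Y)
  (fun p x => existT _ (projT1 x) (sapp (f _) (projT2 x))) _).
by move=> p q d [i x]; congr existT; apply: sapp_face.
Defined.

Definition sinj (I : Type) (X : I -> sset) (i : I) : hom (X i) (scoprod X) :=
  @mksmap (X i) (scoprod X) (fun p x => existT _ i x) (fun _ _ _ _ => erefl).

Definition spow_map (X Y : sset) (n : nat) (f : hom X Y) :
  hom (spow X n) (spow Y n) := spi_map (fun _ => f).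

(* The isomorphism X^n * prod_i (Y_i)^n ~ (X * prod_i Y_i)^n. *)
Definition shuffle (X : sset) (I : Type) (Y : I -> sset) (n : nat) :
  hom (sprod (spow X n) (spi (fun i => spow (Y i) n)))
      (spow (sprod X (spi Y)) n) :=
  @mksmap (sprod (spow X n) (spi (fun i => spow (Y i) n)))
      (spow (sprod X (spi Y)) n)
    (fun p xy j => (xy.1 j, fun i => xy.2 i j)) (fun _ _ _ _ => erefl).

Definition seqs : category.
Proof.
refine (@Category (nat -> sset) (fun X Y => forall m, hom (X m) (Y m))
  (fun X m => idm (X m)) (fun X Y Z g f m => g m \oc f m) _ _ _).
- by move=> X Y f; apply: functional_extensionality_dep => m; apply: cmp1m.
- by move=> X Y f; apply: functional_extensionality_dep => m; apply: cmpm1.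
- by move=> X Y Z T h g f; apply: functional_extensionality_dep => m; apply: cmpA.
Defined.

Definition ar (X : seqs) (m : nat) : sset := (X : nat -> sset) m.
Definition arh (X Y : seqs) (f : hom X Y) (m : nat) : hom (ar X m) (ar Y m) :=
  (f : forall m, _) m.

Definition compositions (k m : nat) : Type :=
  {a : 'I_k -> nat | \sum_i a i = m}.

(* X(k) * Y(a_1) * ... * Y(a_k) *)
Definition summand (X Y : seqs) (k : nat) (a : 'I_k -> nat) : sset :=
  sprod (ar X k) (spi (fun i => ar Y (a i))).

Definition summand_map (X X' Y Y' : seqs) (f : hom X X') (g : hom Y Y')
  (k : nat) (a : 'I_k -> nat) : hom (summand X Y a) (summand X' Y' a) :=
  sprod_map (arh f k) (spi_map (fun i => arh g (a i))).

Definition circ (X Y : seqs) : seqs := fun m =>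
  scoprod (fun k : nat =>
    scoprod (fun a : compositions k m => summand X Y (sval a))).

Definition circ_map (X X' Y Y' : seqs) (f : hom X X') (g : hom Y Y') :
  hom (circ X Y) (circ X' Y') := fun m =>
  scoprod_map (fun k => scoprod_map (fun a : compositions k m =>
    summand_map f g (sval a))).

Definition circ_in (X Y : seqs) (k m : nat) (a : compositions k m) :
  hom (summand X Y (sval a)) (ar (circ X Y) m) :=
  sinj (fun k : nat => scoprod (fun a : compositions k m => summand X Y (sval a))) k
  \oc sinj (fun a : compositions k m => summand X Y (sval a)) a.

Definition circ_elt (X Y : seqs) p k m (a : 'I_k -> nat) (e : \sum_i a i = m)
  (x : lev (ar X k) p) (y : forall i, lev (ar Y (a i)) p) :
  lev (ar (circ X Y) m) p :=
  existT _ k (existT _ (exist _ a e) (x, y)).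

(* The associator (X o Y) o Z -> X o (Y o Z).  Given a composition a of M and
   a family b of M integers, the latter splits into consecutive blocks of
   lengths a_1, ..., a_k; the j-th entry of the i-th block has index
   tagnat.Rank i j. *)
Section Associator.
Variables (k M m : nat) (a : 'I_k -> nat) (eM : \sum_i a i = M).
Variable b : 'I_M -> nat.

Definition block_ix (i : 'I_k) (j : 'I_(a i)) : 'I_M :=
  cast_ord eM (@tagnat.Rank k a i j).

Definition block_sum (i : 'I_k) : nat := \sum_j b (@block_ix i j).

Lemma sum_block_sum : \sum_t b t = m -> \sum_i block_sum i = m.
Proof.
move=> <-; rewrite /block_sum /block_ix; case: _ / eM b => c.
rewrite sig_big_dep /= [RHS](reindex _ tagnat.rank_bij_on) /=.
by apply: eq_bigr => -[i j] _; rewrite /= cast_ord_id.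
Qed.

End Associator.

Definition circ_assoc_fun (X Y Z : seqs) (m p : nat)
  (w : lev (ar (circ (circ X Y) Z) m) p) : lev (ar (circ X (circ Y Z)) m) p :=
  let: existT M (existT (exist b em)
         (existT k (existT (exist a eM) (x, y)), z)) := w in
  circ_elt (X := X) (Y := circ Y Z) (sum_block_sum eM em) x
    (fun i => circ_elt (X := Y) (Y := Z) (erefl (block_sum eM b i)) (y i)
      (fun j => z (block_ix eM j))).

Definition circ_assoc (X Y Z : seqs) :
  hom (circ (circ X Y) Z) (circ X (circ Y Z)).
Proof.
move=> m.
refine (@mksmap (ar (circ (circ X Y) Z) m) (ar (circ X (circ Y Z)) m)
  (@circ_assoc_fun X Y Z m) _).
by move=> p q d [M [[b em] [[k [[a eM] [x y]]] z]]].
Defined.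

(* The unit of the composition product: a point in arity 1, empty elsewhere. *)
Definition unit_seq : seqs := fun m => sconst (m = 1).

(* The inverse unitors X -> I o X and X -> X o I. *)
Definition circ_lunit (X : seqs) : hom X (circ unit_seq X) := fun m =>
  @mksmap (ar X m) (ar (circ unit_seq X) m)
    (fun p x => circ_elt (X := unit_seq) (big_ord1 addn (fun _ => m)) erefl (fun _ => x))
    (fun _ _ _ _ => erefl).

Lemma sum_ones m : \sum_(i < m) 1 = m.
Proof. by rewrite sum1_card card_ord. Qed.

Definition circ_runit (X : seqs) : hom X (circ X unit_seq) := fun m =>
  @mksmap (ar X m) (ar (circ X unit_seq) m)
    (fun p x => circ_elt (Y := unit_seq) (sum_ones m) x (fun _ => erefl))
    (fun _ _ _ _ => erefl).

Definition associative_mul (P : seqs) (mu : hom (circ P P) P) : Prop :=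
  mu \oc circ_map mu (idm P) = mu \oc circ_map (idm P) mu \oc circ_assoc P P P.

Record nu_operad := NuOperad {
  nu_seq :> seqs;
  nu_mul : hom (circ nu_seq nu_seq) nu_seq;
  nu_mulA : associative_mul nu_mul
}.

Definition nu_morphism (P Q : nu_operad) (f : hom (nu_seq P) (nu_seq Q)) : Prop :=
  f \oc nu_mul P = nu_mul Q \oc circ_map f f.

(* Operads are unital: monoids for the composition product. *)
Record operad := Operad {
  op_nu :> nu_operad;
  op_unit : hom unit_seq (nu_seq op_nu);
  op_mul1m : nu_mul op_nu \oc circ_map op_unit (idm (nu_seq op_nu))
             \oc circ_lunit op_nu = idm (nu_seq op_nu);
  op_mulm1 : nu_mul op_nu \oc circ_map (idm (nu_seq op_nu)) op_unit
             \oc circ_runit op_nu = idm (nu_seq op_nu)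
}.

(* P(k) * P(a_1) * ... * P(a_k) -> P(a_1 + ... + a_k) *)
Definition mul_at (P : seqs) (mu : hom (circ P P) P) (k : nat) (a : 'I_k -> nat) :
  hom (summand P P a) (ar P (\sum_i a i)) :=
  arh mu _ \oc circ_in P P (exist _ a erefl).

Definition gamma (n : nat) : functor seqs seqs :=
  @Functor seqs seqs (fun X m => ar X (m * n)) (fun X Y f m => arh f (m * n))
    (fun _ => erefl) (fun _ _ _ _ _ => erefl).

Section Axial.
Variables (n : nat) (P : operad).

Definition iota_family := forall k, hom (ar P (k * n)) (spow (ar P k) n).

(* P(kn) * prod_i P(a_i n) -> P(k)^n * prod_i P(a_i)^n
     ~ (P(k) * prod_i P(a_i))^n -> P(a_1 + ... + a_k)^n *)
Definition axial_mul (iota : iota_family) (k : nat) (a : 'I_k -> nat) :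
  hom (summand (gamma n P) (gamma n P) a) (spow (ar P (\sum_i a i)) n) :=
  spow_map n (mul_at (nu_mul P) a)
  \oc shuffle (ar P k) (fun i => ar P (a i)) n
  \oc sprod_map (iota k) (spi_map (fun i => iota (a i))).

Record axial_structure := AxialStructure {
  ax_iota : iota_family;
  ax_monic : forall k, monic (ax_iota k);
  ax_factor : forall k (a : 'I_k -> nat), 1 <= k ->
    exists muhat : hom (summand (gamma n P) (gamma n P) a)
                       (ar (gamma n P) (\sum_i a i)),
      axial_mul ax_iota a = ax_iota (\sum_i a i) \oc muhat
}.

End Axial.

Record ax_operad (n : nat) := AxOperad {
  ax_op :> operad;
  ax_str : axial_structure n ax_op
}.

Definition iota_of (n : nat) (P : ax_operad n) : iota_family n P :=
  ax_iota (ax_str P).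

Definition ax_morphism (n : nat) (P Q : ax_operad n)
  (f : hom (nu_seq P) (nu_seq Q)) : Prop :=
  [/\ nu_morphism f,
      f \oc op_unit P = op_unit Q &
      forall k, iota_of Q k \oc arh f (k * n) = spow_map n (arh f k) \oc iota_of P k].

Lemma circ_map1 (X Y : seqs) : circ_map (idm X) (idm Y) = idm (circ X Y).
Proof.
apply: functional_extensionality_dep => m; apply: smap_eq.
by move=> p [k [a [x y]]].
Qed.

Lemma circ_mapM (X X' X'' Y Y' Y'' : seqs) (g : hom X' X'') (f : hom X X')
  (g' : hom Y' Y'') (f' : hom Y Y') :
  circ_map (g \oc f) (g' \oc f') = circ_map g g' \oc circ_map f f'.
Proof.
apply: functional_extensionality_dep => m; apply: smap_eq.
by move=> p [k [a [x y]]].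
Qed.

Lemma nu_morphism1 (P : nu_operad) : nu_morphism (P := P) (Q := P) (idm _).
Proof. by rewrite /nu_morphism circ_map1 cmp1m cmpm1. Qed.

Lemma nu_morphismM (P Q R : nu_operad) (g : hom (nu_seq Q) (nu_seq R))
  (f : hom (nu_seq P) (nu_seq Q)) :
  nu_morphism g -> nu_morphism f -> nu_morphism (g \oc f).
Proof.
rewrite /nu_morphism => gP fP.
by rewrite circ_mapM -cmpA fP cmpA gP cmpA.
Qed.

Lemma ax_morphism1 n (P : ax_operad n) : ax_morphism (P := P) (Q := P) (idm _).
Proof.
split; [exact: nu_morphism1 | exact: (cmp1m (op_unit P)) | move=> k].
by apply: smap_eq.
Qed.

Lemma ax_morphismM n (P Q R : ax_operad n) (g : hom (nu_seq Q) (nu_seq R))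
  (f : hom (nu_seq P) (nu_seq Q)) :
  ax_morphism g -> ax_morphism f -> ax_morphism (g \oc f).
Proof.
move=> [g1 g2 g3] [f1 f2 f3]; split; first exact: nu_morphismM.
  by rewrite -cmpA f2.
move=> k; rewrite [arh _ _]/(arh g (k * n) \oc arh f (k * n)).
rewrite cmpA g3 -cmpA f3 cmpA.
by apply: smap_eq.
Qed.

Definition OpNu : category :=
  structured (u := nu_seq) nu_morphism1 nu_morphismM.
Definition OpNu_forget : functor OpNu seqs :=
  forget (u := nu_seq) nu_morphism1 nu_morphismM.

Definition OpAx (n : nat) : category :=
  structured (u := fun P : ax_operad n => nu_seq P)
    (@ax_morphism1 n) (@ax_morphismM n).
Definition OpAx_forget (n : nat) : functor (OpAx n) seqs :=
  forget (u := fun P : ax_operad n => nu_seq P)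
    (@ax_morphism1 n) (@ax_morphismM n).

(* mu is the multiplication on gamma_n(P) corestricting the product
   multiplication along iota, i.e. mu is given by the maps muhat. *)
Definition axial_induced (n : nat) (P : ax_operad n)
  (mu : hom (circ (gamma n P) (gamma n P)) (gamma n P)) : Prop :=
  forall k (a : 'I_k -> nat),
    axial_mul (iota_of P) a = iota_of P (\sum_i a i) \oc mul_at mu a.

(* Main.v *)
(* Since [iota] is monic, the maps [muhat] of an axial structure determine the
   multiplication of [gamma n P], and every identity between maps into
   [gamma n P] may be checked after composing with [iota], where it becomes,
   coordinate by coordinate, the same identity for [P].  An axial structure
   says nothing about [k = 0]; there the unit of [P] gives [mu(c;) = c] for
   [c] in [P(0)], so that the identity of [P(0)] serves as [muhat]. *)
From mathcomp Require Import all_boot boolp.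
Require Import Defs.

Set Implicit Arguments.
Unset Strict Implicit.
Unset Printing Implicit Defensive.

Lemma functor_eq (C D : category) (o : C -> D)
  (f g : forall x y, hom x y -> hom (o x) (o y)) f1 fM g1 gM :
  f = g -> @Functor C D o f f1 fM = @Functor C D o g g1 gM.
Proof.
by move=> fg; subst g; congr Functor; apply: Prop_irrelevance.
Qed.

Definition scopair (I : Type) (X : I -> sset) (Y : sset)
  (f : forall i, hom (X i) Y) : hom (scoprod X) Y.
Proof.
refine (@mksmap (scoprod X) Y (fun p x => sapp (f (projT1 x)) (projT2 x)) _).
by move=> p q d [i x]; apply: sapp_face.
Defined.

Lemma sapp_eq (X Y : seqs) (f g : hom X Y) m p (x : lev (ar X m) p) :
  f = g -> sapp (arh f m) x = sapp (arh g m) x.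
Proof. by move->. Qed.

Lemma spow_app_eq (X Y : sset) n (f g : hom X (spow Y n)) p (x : lev X p) j :
  f = g -> sapp f x j = sapp g x j.
Proof. by move->. Qed.

Definition sproj1 (X Y : sset) : hom (sprod X Y) X :=
  @mksmap (sprod X Y) X (fun p xy => xy.1) (fun _ _ _ _ => erefl).

(** Any two families indexed by ['I_0] agree, so [y] may be taken to consist of units, and the right
    unit law of [P] applies. *)
Lemma operad_mul_arity0 (P : operad) (a : 'I_0 -> nat) (e : \sum_i a i = 0) p
  (c : lev (ar P 0) p) (y : forall i, lev (ar P (a i)) p) :
  sapp (arh (nu_mul P) 0) (circ_elt (X := P) (Y := P) e c y) = c.
Proof.
apply: etrans _ (sapp_eq (m := 0) c (op_mulm1 P)).
have aE : (fun=> 1) = a by apply: funext => -[].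
case: _ / aE e y => e y; congr (sapp _ _).
rewrite (Prop_irrelevance e (sum_ones 0)).
have -> : y = fun i => sapp (arh (op_unit P) 1) (erefl : lev (ar unit_seq 1) p).
  by apply: functional_extensionality_dep => -[].
by [].
Qed.

Section AxialMultiplication.
Variables (n : nat) (P : ax_operad n).
Notation G := (gamma n P).

(** Letting [m] be a variable, not literally the sum of the entries, gives all these maps the one
    target [ar G m], as a map out of the coproduct [circ G G] requires. *)
Lemma muhat_exists k m (a : compositions k m) :
  exists muhat : hom (summand G G (sval a)) (ar G m),
  forall p (x : lev (ar G k) p) (y : forall i, lev (ar G (sval a i)) p) j,
  sapp (iota_of P m) (sapp muhat (x, y)) j =
  sapp (arh (nu_mul P) m)
    (circ_elt (X := P) (Y := P) (proj2_sig a) (sapp (iota_of P k) x j)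
       (fun i => sapp (iota_of P (sval a i)) (y i) j)).
Proof.
case: a => a e /=; case: k a e => [|k] a e.
  have m0 : 0 = m by rewrite -e big_ord0.
  (* [0 * n] reduces to [0], so [ar G 0] is [P(0)] itself; the other factor is an empty product. *)
  case: _ / m0 e => e; exists (sproj1 _ _) => p x y j.
  by rewrite operad_mul_arity0.
case: _ / e; have [muhat muhatP] := ax_factor (ax_str P) a (ltn0Sn k).
exists muhat => p x y j.
exact: esym (spow_app_eq ((x, y) : lev (summand G G a) p) j muhatP).
Qed.

(** The choice made by [cid] is harmless: [iota] is monic, so only one [muhat] is possible. *)
Definition axial_nu_mul : hom (circ G G) G := fun m =>
  scopair (fun k => scopair (fun a : compositions k m =>
    sval (cid (muhat_exists a)))).

Lemma iota_axial_nu_mul k m p (a : 'I_k -> nat) (e : \sum_i a i = m)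
  (x : lev (ar G k) p) (y : forall i, lev (ar G (a i)) p) j :
  sapp (iota_of P m)
    (sapp (arh axial_nu_mul m) (circ_elt (X := G) (Y := G) e x y)) j =
  sapp (arh (nu_mul P) m)
    (circ_elt (X := P) (Y := P) e (sapp (iota_of P k) x j)
       (fun i => sapp (iota_of P (a i)) (y i) j)).
Proof. exact: (svalP (cid (muhat_exists (exist _ a e)))). Qed.

Lemma iota_inj (X : seqs) (f g : hom X G) :
  (forall m p (x : lev (ar X m) p) j,
     sapp (iota_of P m) (sapp (arh f m) x) j =
     sapp (iota_of P m) (sapp (arh g m) x) j) -> f = g.
Proof.
move=> fg; apply: functional_extensionality_dep => m.
apply: (ax_monic (a0 := ax_str P)); apply: smap_eq => p x.
by apply: functional_extensionality_dep => j; apply: fg.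
Qed.

Lemma axial_nu_mulA : associative_mul axial_nu_mul.
Proof.
apply: iota_inj => m p [M [[b em] [[k [[a eM] [x y]]] z]]] j.
(* Associativity in [P], applied to the [j]-th coordinates of [x], [y] and [z] under [iota]. *)
have := sapp_eq (m := m) (circ_elt (X := circ P P) (Y := P) em
  (circ_elt (X := P) (Y := P) eM (sapp (iota_of P k) x j)
     (fun i => sapp (iota_of P (a i)) (y i) j))
  (fun i => sapp (iota_of P (b i)) (z i) j)) (nu_mulA P).
set l := (X in X = _); set r := (X in _ = X) => lr.
transitivity l.
  apply: etrans (iota_axial_nu_mul _ _ _ _) _.
  by rewrite [X in circ_elt em X](iota_axial_nu_mul eM x y j).
rewrite lr; symmetry.
apply: etrans (iota_axial_nu_mul (sum_block_sum eM em) _ _ _) _.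
congr (sapp _ (circ_elt _ _ _)).
(* On this side there is one inner multiplication for each block of [b]. *)
by apply: functional_extensionality_dep => i; apply: iota_axial_nu_mul.
Qed.

Lemma axial_nu_mul_induced : axial_induced axial_nu_mul.
Proof.
move=> k a; apply: smap_eq => p [x y].
apply: functional_extensionality_dep => j.
exact: esym (iota_axial_nu_mul erefl x y j).
Qed.

End AxialMultiplication.

Definition gamma_nu (n : nat) (P : ax_operad n) : nu_operad :=
  NuOperad (axial_nu_mulA P).

(** Since [f] commutes with the maps [iota], applying [iota_of Q] turns the claim, in each
    coordinate, into the compatibility of [f] with the multiplications of [P] and [Q]. *)
Lemma gamma_nu_morphism n (P Q : ax_operad n)
  (f : hom (nu_seq P) (nu_seq Q)) : ax_morphism f ->
  nu_morphism (P := gamma_nu P) (Q := gamma_nu Q) (fmap (gamma n) f).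
Proof.
move=> [fM _ fiota].
have iotaE k p (x : lev (ar P (k * n)) p) j :
    sapp (iota_of Q k) (sapp (arh f (k * n)) x) j =
    sapp (arh f k) (sapp (iota_of P k) x j).
  exact: (spow_app_eq x j (fiota k)).
apply: iota_inj => m p [k [[a e] [x y]]] j.
apply: etrans (iotaE _ _ _ _) _.
rewrite [X in sapp _ X = _](iota_axial_nu_mul e x y j).
apply: etrans (sapp_eq (m := m) _ fM) _; symmetry.
apply: etrans (iota_axial_nu_mul e _ _ _) _.
rewrite iotaE; congr (sapp _ (circ_elt _ _ _)).
by apply: functional_extensionality_dep => i; apply: iotaE.
Qed.

Definition gamma_ax (n : nat) : functor (OpAx n) OpNu.
Proof.
refine (@Functor (OpAx n) OpNu (@gamma_nu n)
  (fun P Q f => exist _ _ (gamma_nu_morphism (svalP f))) _ _).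
- by move=> P; apply: sval_eq.
- by move=> P Q R g f; apply: sval_eq.
Defined.

Theorem proposition2p11 (n : nat) :
  exists F : functor (OpAx n) OpNu,
    fcomp OpNu_forget F = fcomp (gamma n) (OpAx_forget n) /\
    forall P : OpAx n,
      exists (mu : hom (circ (gamma n P) (gamma n P)) (gamma n P))
             (muA : associative_mul mu),
        F P = NuOperad muA /\ axial_induced mu.
Proof.
(* The two composites agree on objects and morphisms by computation; only the proofs of the functor
   laws differ. *)
exists (gamma_ax n); split; first exact: functor_eq.
move=> P; exists (axial_nu_mul P), (axial_nu_mulA P); split=> //.
exact: axial_nu_mul_induced.
Qed.
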